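(* Let $\mathbf{c}_0$ be a binary initial configuration on the directed path $P_n$ with $|\mathbf{c}_0|=n-1$, i.e. $\mathbf{c}_0$ contains a single zero. Then $$\mathcal{A}(P_n,\mathbf{c}_0)\simeq\begin{cases}S^{\lfloor\frac n2\rfloor-1}, & \text{if } \mathbf{c}_0(v_i)=0 \text{ for } i=\lfloor\frac n2\rfloor+1,\\ \ast, & \text{otherwise.}\end{cases}$$
   Context: $P_n$ is the directed path with vertices $v_1,\dots,v_{n+1}$ and edges $(v_i,v_{i+1})$ for $i=1,\dots,n$. The vertex $v_{n+1}$ is a sink: it never fires, absorbs grains, and is not included in configurations or in the avalanche complex. A configuration is a vector $\mathbf{c}\in\mathbb{N}^n$ ($0\in\mathbb{N}$), where $\mathbf{c}(v_i)$ is the number of grains on $v_i$, $1\le i\le n$; it is binary if every entry is $0$ or $1$; $|\mathbf{c}|$ is the sum of its entries. Parallel-firing sandpile dynamics started from $\mathbf{c}_0$: at each time $t=0,1,2,\dots$ the firing set $\sigma_t$ is the set of $v_i$, $1\le i\le n$, with $\mathbf{c}_t(v_i)\ge 1$; all of these fire simultaneously, each sending one grain to $v_{i+1}$, so that $\mathbf{c}_{t+1}(v_i)=\mathbf{c}_t(v_i)-[v_i\in\sigma_t]+[v_{i-1}\in\sigma_t]$ for $1\le i\le n$ (where $[\cdot]$ is $1$ if the condition holds and $0$ otherwise, and the last term is $0$ for $i=1$). The avalanche complex $\mathcal{A}(P_n,\mathbf{c}_0)$ is the simplicial complex generated by the firing sets, i.e. the simplices are all nonempty subsets of the sets $\sigma_t$,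 $t\ge 0$ (vertices that never fire are not vertices of the complex). $\simeq$ denotes homotopy equivalence, $\ast$ is a point, and $S^{-1}=\emptyset$ (relevant only for $n=1$). *)

(* Defs.v *)
From HB Require Import structures.
From mathcomp Require Import all_boot all_order all_algebra.
From mathcomp Require Import all_classical all_reals all_analysis.
Import numFieldNormedType.Exports.

Set Implicit Arguments.
Unset Strict Implicit.
Unset Printing Implicit Defensive.

Import Order.TTheory GRing.Theory Num.Theory.

Local Open Scope classical_set_scope.
Local Open Scope ring_scope.

(* The vertex v_i (1 <= i <= n) of P_n is the ordinal of value i - 1; the sink
   v_{n+1} is not represented. *)
Definition configuration (n : nat) := {ffun 'I_n -> nat}.

Definition path_edge n (i j : 'I_n) : bool := j == i.+1 :> nat.

Definition binary n (c : configuration n) : Prop :=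
  forall i, c i = 0%N \/ c i = 1%N.

Definition grains n (c : configuration n) : nat := (\sum_(i < n) c i)%N.

Definition firing_set n (c : configuration n) : {set 'I_n} :=
  [set i | (1 <= c i)%N]%SET.

(* The truncated subtraction is exact: a vertex that fires has a grain. *)
Definition parallel_fire n (c : configuration n) : configuration n :=
  [ffun i => (c i - (i \in firing_set c)
              + [exists j in firing_set c, path_edge j i])%N].

Definition config_at n (c0 : configuration n) (t : nat) : configuration n :=
  iter t (@parallel_fire n) c0.

(* Simplices are the nonempty ones; an element of V need not be a vertex of the
   complex. *)
Record simplicial_complex (V : finType) := SimplicialComplex {
  simplices : set {set V};
  simplices_neq0 : forall s, simplices s -> s != finset.set0;
  simplices_sub : forall s s' : {set V},
    simplices s -> s' \subset s -> s' != finset.set0 -> simplices s' }.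

Section GeneratedComplex.
Variables (V : finType) (F : set {set V}).

Let faces : set {set V} :=
  [set s : {set V} | s != finset.set0 /\ exists2 f, F f & s \subset f].

Let faces_neq0 s : faces s -> s != finset.set0.
Proof. by case. Qed.

Let faces_sub (s s' : {set V}) :
  faces s -> s' \subset s -> s' != finset.set0 -> faces s'.
Proof.
move=> [_ [f Ff sf]] s's s'0; split=> //; exists f => //.
exact: (fintype.subset_trans s's sf).
Qed.

Definition generated_complex : simplicial_complex V :=
  SimplicialComplex faces_neq0 faces_sub.

End GeneratedComplex.

Definition avalanche_complex n (c0 : configuration n) :
    simplicial_complex 'I_n :=
  generated_complex (range (fun t => firing_set (config_at c0 t))).

(* Barycentric coordinates; the standard realization inside R^n of a complex
   whose vertices are among those of the standard simplex. *)
Definition realization (R : realType) n (K : simplicial_complex 'I_n) :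
    set 'rV[R]_n :=
  [set x : 'rV[R]_n | [/\ forall i, 0 <= x ord0 i, \sum_(i < n) x ord0 i = 1
                    & simplices K [set i | x ord0 i != 0]%SET]].

(* The unit sphere S^(d-1) of R^d for the Euclidean norm (the library norm on
   'rV[R]_d is the sup norm). For d = 0 it is the empty sphere S^(-1). *)
Definition unit_sphere (R : realType) (d : nat) : set 'rV[R]_d :=
  [set x : 'rV[R]_d | \sum_(i < d) x ord0 i ^+ 2 = 1].

Arguments realization R {n} K.
Arguments unit_sphere R d : clear implicits.

Definition homotopic (R : realType) (X Y : topologicalType) (f g : X -> Y) :
    Prop :=
  exists H : X * R -> Y,
    [/\ {within [set: X] `*` `[0, 1], continuous H},
        forall x, H (x, 0) = f x & forall x, H (x, 1) = g x].

(* A and B are seen as spaces, with the subspace topology. *)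
Definition homotopy_equiv (R : realType) (T U : topologicalType)
    (A : set T) (B : set U) : Prop :=
  exists (f : set_type A -> set_type B) (g : set_type B -> set_type A),
    [/\ continuous f, continuous g,
        homotopic R (g \o f) idfun & homotopic R (f \o g) idfun].

(* Main.v *)
Require Import Defs.
From HB Require Import structures.
From mathcomp Require Import all_boot all_order all_algebra.
From mathcomp Require Import all_classical all_reals all_analysis.
From mathcomp Require Import zify ring.
Import numFieldNormedType.Exports.

(** Every configuration stays binary: an occupied vertex always passes its only
    grain on, so parallel firing is the shift by one vertex.  Number the vertices
    from 0 and let k be the vertex of the zero; then
      sigma_t = {i | t <= i, i <> k + t}        ([firing_set_shift]).
    So a nonempty set s is a simplex iff for some t <= min s the vertex k + t is
    not in s ([avalanche_simplicesP]).  Put p = n./2.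

    If k <> p, some vertex v can be added to every simplex, so the complex is a
    cone and the straight-line homotopy to v contracts it ([cone_contractible],
    [avalanche_contractible]).  For k < p the last vertex works: the only nonempty
    sigma_t without it has t = n - 1 - k > k, and a simplex inside that sigma_t
    lies beyond k, so in sigma_0 too.  For k > p the vertex (n - 1)./2 works: it
    lies below k, and a simplex that starts after it lies in the sigma_t with
    t = (n - 1)./2, which is all of {i | t <= i} as k + t >= n.

    If k = p, take the p vertices b_j = p + j (j < p) and one more vertex z: the
    last one, 2 p, if n = 2 p + 1, and p - 1 if n = 2 p.  They span p + 1
    vertices whose whole set is not a simplex while every nonempty proper subset
    is: sigma_t misses b_t for t < p, and sigma_p misses z.  The simplicial map
    that fixes these vertices and sends all others to z is contiguous to the
    identity: the simplex and its image span a simplex.  Hence the complex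
    retracts by a straight-line homotopy onto the boundary of a p-simplex, which
    is a (p - 1)-sphere.

    The latter step needs no composition of homotopy equivalences.  With x_z
    standing for the total weight outside the b_j, let f(x) be the normalization
    of the vector (x_{b_j} - x_z)_j in R^p, and let g(y) be obtained from (y, 0)
    by subtracting the minimum of the p + 1 coordinates and dividing by their
    sum.  On the boundary of a simplex the minimal coordinate is 0, so g (f x) is
    exactly the retraction of x, and f (g y) = y for every unit vector y
    ([homotopy_equiv_sphere], [avalanche_sphere]). *)

Set Implicit Arguments.
Unset Strict Implicit.
Unset Printing Implicit Defensive.

Import Order.TTheory GRing.Theory Num.Theory.

Local Open Scope classical_set_scope.
Local Open Scope ring_scope.

(** * Continuity and straight-line homotopies *)

Lemma mx_continuous (R : numFieldType) (T : topologicalType) m n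
    (f : T -> 'M[R]_(m, n)) (x : T) :
  (forall i j, {for x, continuous (fun u => f u i j)}) ->
  {for x, continuous f}.
Proof.
move=> cf U /= [P nP PU].
apply: (@filterS _ (nbhs x) _ _ _ (fun u Pu => PU _ Pu)).
by apply: filter_forall => i; apply: filter_forall => j; apply: cf; apply: nP.
Qed.

Lemma sum_continuous (R : numFieldType) (T : topologicalType) (I : Type)
    (r : seq I) (P : pred I) (F : I -> T -> R) (x : T) :
  (forall i, {for x, continuous (F i)}) ->
  {for x, continuous (fun u => \sum_(i <- r | P i) F i u)}.
Proof.
move=> cF; elim: r => [|i r IH].
  under [X in {for x, continuous X}]eq_fun do rewrite big_nil.
  exact: cst_continuous.
under [X in {for x, continuous X}]eq_fun do rewrite big_cons.
by case: (P i) => //; apply: continuousD.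
Qed.

Lemma set_val_continuous (T : topologicalType) (A : set T) :
  continuous (val : set_type A -> T).
Proof. exact: initial_continuous. Qed.

(** [homotopy_equiv] speaks of maps between subtypes; this builds them from a
    map of the ambient spaces, for which continuity is easier to check. *)
Definition corestrict (T U : topologicalType) (A : set T) (B : set U)
    (h : T -> U) (hAB : forall a, A a -> B (h a)) (a : set_type A) : set_type B :=
  SigSub (mem_set (hAB _ (set_valP a))).

Lemma corestrict_continuous (T U : topologicalType) (A : set T) (B : set U)
    (h : T -> U) (hAB : forall a, A a -> B (h a)) :
  (forall a, A a -> {for a, continuous h}) -> continuous (corestrict hAB).
Proof.
move=> ch; apply: continuous_comp_initial => a.
apply: (@continuous_comp _ _ _ (val : set_type A -> T) h).
  exact: set_val_continuous.
exact/ch/set_valP.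
Qed.

(** When [f \o g] is the identity, it is enough that the segments from
    [g (f a)] to [a] stay in [A]: the homotopy runs along them. *)
Lemma convex_homotopy_equiv (R : realType) n (T : topologicalType)
    (A : set 'rV[R]_n) (B : set T)
    (f : set_type A -> set_type B) (g : set_type B -> set_type A) :
  continuous f -> continuous g -> (forall b, f (g b) = b) ->
  (forall (a : set_type A) (t : R), 0 <= t <= 1 ->
     A ((1 - t) *: val (g (f a)) + t *: val a)) ->
  homotopy_equiv R A B.
Proof.
move=> cf cg fgK Aseg; exists f, g; split=> //.
  (* The homotopy must be total in the time variable with values in [A], so the
     time is first brought into [0, 1]. *)
  pose clamp (t : R) := Num.max 0 (Num.min 1 t).
  have clamp01 t : 0 <= clamp t <= 1.
    by rewrite /clamp le_max lexx ge_max ler01 ge_min lexx.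
  pose H (p : set_type A * R) : set_type A :=
    SigSub (mem_set (Aseg p.1 (clamp p.2) (clamp01 p.2))).
  exists H; split=> [|a|a]; last 2 first.
  - apply: val_inj => /=; rewrite /clamp minElt ltr10 maxxx.
    by rewrite subr0 scale1r scale0r addr0.
  - apply: val_inj => /=; rewrite /clamp minxx maxElt ltr01.
    by rewrite subrr scale1r scale0r add0r.
  apply: continuous_subspaceT; apply: continuous_comp_initial => p.
  have c_clamp : {for p, continuous (fun q : set_type A * R => clamp q.2)}.
    apply: (@continuous_max _ _ (fun=> 0)); first exact: cst_continuous.
    apply: (@continuous_min _ _ (fun=> 1)); first exact: cst_continuous.
    exact: cvg_snd.
  have c1 : {for p, continuous (fun q : set_type A * R => val q.1)}.
    apply: (@continuous_comp _ _ _ fst); first exact: cvg_fst.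
    exact: set_val_continuous.
  have c2 : {for p, continuous (fun q : set_type A * R => val (g (f q.1)))}.
    apply: (@continuous_comp _ _ _ fst (fun a => val (g (f a)))).
      exact: cvg_fst.
    apply: (@continuous_comp _ _ _ (fun a => g (f a))).
      by apply: continuous_comp; [exact: cf|exact: cg].
    exact: set_val_continuous.
  apply: mx_continuous => i j.
  apply: (@continuous_comp _ _ _ _ (fun u : 'rV_n => u i j));
    last exact: coord_continuous.
  apply: continuousD.
    apply: continuousZ; last exact: c2.
    by apply: continuousB => //; exact: cst_continuous.
  exact: continuousZ.
exists fst; split=> //; last by move=> b; rewrite /= fgK.
by apply: continuous_subspaceT => p; exact: cvg_fst.
Qed.

(** * Segments in a geometric realization *)

(** The support of a point of the segment is contained in the union of the
    supports of its ends, so it is a simplex as soon as that union lies in one. *)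
Lemma segment_in_realization (R : realType) n (K : simplicial_complex 'I_n)
    (x y : 'rV[R]_n) (s : {set 'I_n}) (t : R) :
  realization R K x -> realization R K y -> simplices K s ->
  (forall i, x ord0 i != 0 -> i \in s) ->
  (forall i, y ord0 i != 0 -> i \in s) ->
  0 <= t <= 1 -> realization R K ((1 - t) *: x + t *: y).
Proof.
move=> [x0 x1 _] [y0 y1 _] Ks xs ys /andP[t0 t1].
set z := _ + _; have zE i : z ord0 i = (1 - t) * x ord0 i + t * y ord0 i.
  by rewrite !mxE.
have z0 i : 0 <= z ord0 i by rewrite zE addr_ge0 // mulr_ge0 // subr_ge0.
have z1 : \sum_i z ord0 i = 1.
  under eq_bigr do rewrite zE.
  by rewrite big_split -!mulr_sumr x1 y1 /=; ring.
split=> //; apply: simplices_sub Ks _ _.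
  apply/fintype.subsetP => i; rewrite inE zE; apply: contraR => si.
  have [-> ->] : x ord0 i = 0 /\ y ord0 i = 0.
    by split; apply/eqP; apply: contraR si; [apply: xs|apply: ys].
  by rewrite !mulr0 addr0.
(* The support is nonempty since the coordinates sum to 1. *)
apply/set0Pn; apply/existsP; apply: contra_eqT z1 => /existsPn zs.
rewrite big1 ?(eq_sym 0) ?oner_eq0 // => i _.
by have := zs i; rewrite inE negbK => /eqP.
Qed.

(** Each point and the vertex [v] lie in a common simplex, so segments to [v]
    contract the realization. *)
Lemma cone_contractible (R : realType) n (K : simplicial_complex 'I_n)
    (v : 'I_n) :
  simplices K [set v]%SET ->
  (forall s, simplices K s -> simplices K (v |: s)%SET) ->
  homotopy_equiv R (realization R K) [set (0 : R)].
Proof.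
move=> Kv Kcone; pose ev : 'rV[R]_n := delta_mx ord0 v.
have evE i : ev ord0 i = (i == v)%:R by rewrite mxE eqxx.
have ev_in : realization R K ev.
  split=> [i||].
  - by rewrite evE ler0n.
  - under eq_bigr do rewrite evE.
    by rewrite (bigD1 v) //= eqxx big1 ?addr0 // => i /negbTE ->.
  - suff -> : [set i | ev ord0 i != 0]%SET = [set v]%SET by [].
    by apply/setP=> i; rewrite !inE evE pnatr_eq0 eqb0 negbK.
pose f (a : set_type (realization R K)) : set_type [set (0 : R)] :=
  SigSub (mem_set (erefl (0 : R))).
pose g (b : set_type [set (0 : R)]) : set_type (realization R K) :=
  SigSub (mem_set ev_in).
apply: (@convex_homotopy_equiv _ _ _ _ _ f g).
- exact: cst_continuous.
- exact: cst_continuous.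
- by move=> b; apply: val_inj => /=; rewrite (set_valP b).
- move=> a t t01; have [_ _ Ka] := set_valP a.
  apply: (segment_in_realization _ (set_valP a) (Kcone _ Ka) _ _ t01) => //= i.
    by rewrite evE pnatr_eq0 eqb0 negbK => /eqP ->; rewrite setU11.
  by move=> ai; apply/setU1P; right; rewrite inE; exact: ai.
Qed.

(** * Normalization onto the Euclidean sphere *)

Section Normalization.
Variables (R : realType) (p : nat).
Implicit Types y : 'rV[R]_p.

Definition enorm y : R := Num.sqrt (\sum_j y ord0 j ^+ 2).

Definition normalize y : 'rV[R]_p := (enorm y)^-1 *: y.

Lemma enorm_gt0 y : y != 0 -> 0 < enorm y.
Proof.
have sq0 j : 0 <= y ord0 j ^+ 2 by exact: sqr_ge0.
move=> y0; rewrite sqrtr_gt0 lt_neqAle sumr_ge0 // andbT.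
apply: contra y0; rewrite eq_sym psumr_eq0 // => /allP y0.
apply/eqP/rowP => j; rewrite mxE; apply/eqP; rewrite -sqrf_eq0.
by apply: y0; rewrite mem_index_enum.
Qed.

Lemma enormZ (a : R) y : 0 <= a -> enorm (a *: y) = a * enorm y.
Proof.
move=> a0; rewrite /enorm.
under eq_bigr do rewrite mxE exprMn.
by rewrite -mulr_sumr sqrtrM ?sqr_ge0 // sqrtr_sqr ger0_norm.
Qed.

Lemma unit_sphereE y : unit_sphere R p y <-> enorm y = 1.
Proof.
rewrite /unit_sphere /enorm /=; split=> [->|y1]; first by rewrite sqrtr1.
rewrite -[LHS]sqr_sqrtr ?y1 ?expr1n //.
by apply: sumr_ge0 => j _; exact: sqr_ge0.
Qed.

Lemma normalize_sphere y : y != 0 -> unit_sphere R p (normalize y).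
Proof.
move=> /enorm_gt0 y0; apply/unit_sphereE.
by rewrite enormZ ?invr_ge0 ?ltW // mulVf ?gt_eqF.
Qed.

Lemma normalize_continuous y : y != 0 -> {for y, continuous normalize}.
Proof.
move=> y0; apply: continuousZ; last exact: cvg_id.
apply: continuousV; first by rewrite gt_eqF ?enorm_gt0.
apply: (@continuous_comp _ _ _ _ Num.sqrt); last exact: sqrt_continuous.
apply: sum_continuous => j.
under [X in {for _, continuous X}]eq_fun do rewrite expr2.
by apply: continuousM; exact: coord_continuous.
Qed.

Lemma normalize_id (a : R) y : 0 < a -> enorm y = 1 -> normalize (a *: y) = y.
Proof.
move=> a0 y1; rewrite /normalize enormZ ?ltW // y1 mulr1 scalerA.
by rewrite mulVf ?scale1r ?gt_eqF.
Qed.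

Lemma sphere_neq0 y : unit_sphere R p y -> y != 0.
Proof.
move=> y1; apply/eqP => y0; move: y1; rewrite /unit_sphere /= y0.
rewrite big1 => [/eqP|j _]; first by rewrite eq_sym oner_eq0.
by rewrite mxE expr0n.
Qed.

End Normalization.

(** * The boundary of a simplex as a sphere *)

Section SphereCoordinates.
Variables (R : realType) (n p : nat) (b : 'I_p -> 'I_n) (z : 'I_n).
Hypotheses (b_inj : injective b) (bz : forall j, b j != z).
Implicit Types (x : 'rV[R]_n) (y : 'rV[R]_p).

(** The vertices [b j] and [z] span the simplex whose boundary will be the
    sphere; [z] is its apex, the vertex that receives everything off the rim. *)
Definition rim : {set 'I_n} := (z |: [set b j | j in 'I_p])%SET.

Definition to_rim (v : 'I_n) : 'I_n := if v \in codom b then v else z.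

Definition place (c : R) (w : 'I_p -> R) : 'rV[R]_n :=
  \row_i ((i == z)%:R * c + \sum_(j | b j == i) w j).

Lemma place_apex c w : place c w ord0 z = c.
Proof.
by rewrite mxE eqxx mul1r big_pred0 ?addr0 // => j; apply/negbTE.
Qed.

Lemma place_rim c w j : place c w ord0 (b j) = w j.
Proof.
rewrite mxE (negbTE (bz j)) mul0r add0r (bigD1 j) //= big1 ?addr0 //.
by move=> i /andP[/eqP /b_inj ->]; rewrite eqxx.
Qed.

Lemma place_support c w i : place c w ord0 i != 0 ->
  (i = z /\ c != 0) \/ exists2 j, i = b j & w j != 0.
Proof.
have [-> |iz] := eqVneq i z; first by rewrite place_apex; left.
case: (pickP (fun j => b j == i)) => [j /eqP <-|bi].
  by rewrite place_rim; right; exists j.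
by rewrite mxE (negbTE iz) mul0r add0r big_pred0 // eqxx.
Qed.

Lemma sum_place c w : \sum_i place c w ord0 i = c + \sum_j w j.
Proof.
under eq_bigr do rewrite mxE.
rewrite big_split /= (bigD1 z) //= eqxx mul1r big1 ?addr0 => [|i /negbTE ->].
  congr (c + _); rewrite (exchange_big_dep predT) //=.
  by apply: eq_bigr => j _; rewrite (big_pred1 (b j)).
by rewrite mul0r.
Qed.

Lemma place_ge0 c w i : 0 <= c -> (forall j, 0 <= w j) -> 0 <= place c w ord0 i.
Proof.
by move=> c0 w0; rewrite mxE addr_ge0 ?mulr_ge0 ?ler0n ?sumr_ge0.
Qed.

(** For barycentric coordinates this is the weight that [to_rim] brings to
    [z], written through the [x ord0 (b j)] alone to make continuity evident. *)
Definition apex_weight x : R := 1 - \sum_j x ord0 (b j).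

Lemma apex_weightE x : \sum_i x ord0 i = 1 ->
  apex_weight x = \sum_(i | i \notin codom b) x ord0 i.
Proof.
move=> x1; apply/eqP; rewrite /apex_weight subr_eq addrC -x1; apply/eqP.
rewrite (bigID (mem (codom b))) /=; congr (_ + _).
rewrite -big_uniq /=; last by rewrite map_inj_uniq ?enum_uniq.
by rewrite /codom /image_mem big_map big_enum.
Qed.

Definition deviation x : 'rV[R]_p :=
  \row_j (x ord0 (b j) - apex_weight x).

(** The minimum of the p + 1 coordinates of the vector [y] extended by 0, the
    latter being the coordinate of the apex. *)
Definition low y : R := \big[Num.min/0]_j y ord0 j.

Lemma low_le0 y : low y <= 0. Proof. exact: bigmin_le_id. Qed.

Lemma low_le y j : low y <= y ord0 j.
Proof. exact: (bigmin_le _ j (fun j => y ord0 j)). Qed.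

Lemma low_attained y : low y = 0 \/ exists j, low y = y ord0 j.
Proof.
rewrite /low; elim/big_ind : _ => [|u v Hu Hv|j _]; first by left.
  by case: leP.
by right; exists j.
Qed.

Definition height y : R := - low y + \sum_j (y ord0 j - low y).

(** All p + 1 summands are nonnegative, and they vanish together only if all the
    coordinates of [y] equal that of the apex, which is 0. *)
Lemma height_gt0 y : y != 0 -> 0 < height y.
Proof.
have w0 j : 0 <= y ord0 j - low y by rewrite subr_ge0 low_le.
have l0 : 0 <= - low y by rewrite oppr_ge0 low_le0.
have sw0 : 0 <= \sum_j (y ord0 j - low y) by apply: sumr_ge0.
move=> y0; rewrite lt_neqAle addr_ge0 // andbT eq_sym.
apply: contra y0; rewrite paddr_eq0 // oppr_eq0 => /andP[/eqP ly].
rewrite psumr_eq0 // => /allP y0; apply/eqP/rowP => j; rewrite mxE.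
by have := y0 j; rewrite mem_index_enum ly subr0 => /(_ isT)/eqP.
Qed.

(** Subtracting the minimum makes the coordinates nonnegative with at least one
    equal to 0: the point lies on the boundary of the simplex. *)
Definition onto_boundary y : 'rV[R]_n :=
  place (- low y / height y) (fun j => (y ord0 j - low y) / height y).

Lemma deviation_continuous : continuous deviation.
Proof.
move=> x; apply: mx_continuous => i j.
under [X in {for _, continuous X}]eq_fun do rewrite mxE.
apply: continuousB; first exact: coord_continuous.
apply: continuousB; first exact: cst_continuous.
by apply: sum_continuous => k; exact: coord_continuous.
Qed.

Lemma low_continuous : continuous low.
Proof.
move=> y; apply: (@continuous_big R^o _ Num.min) => [|j _].
  exact: min_continuous.
exact: coord_continuous.
Qed.

Lemma height_continuous : continuous height.
Proof.
move=> y; rewrite /height.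
apply: (@continuousD R R^o _ (fun u => - low u)).
  by apply: (@continuousN R R^o); exact: low_continuous.
apply: sum_continuous => j.
by apply: (@continuousB R R^o); [exact: coord_continuous|exact: low_continuous].
Qed.

Lemma onto_boundary_continuous y : y != 0 -> {for y, continuous onto_boundary}.
Proof.
move=> y0; have cV : {for y, continuous (fun u => (height u)^-1)}.
  by apply: continuousV; [rewrite gt_eqF ?height_gt0|exact: height_continuous].
apply: mx_continuous => i k.
under [X in {for _, continuous X}]eq_fun do rewrite mxE.
apply: (@continuousD R R^o _
  (fun u => (k == z)%:R * (- low u / height u))).
  apply: continuousM; first exact: cst_continuous.
  apply: continuousM => //.
  by apply: (@continuousN R R^o); exact: low_continuous.
apply: sum_continuous => j; apply: continuousM => //.
by apply: (@continuousB R R^o); [exact: coord_continuous|exact: low_continuous].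
Qed.

(** The differences with the coordinate of the apex do not see the subtraction
    of the minimum; only the scaling by the height remains. *)
Lemma deviation_onto_boundary y : y != 0 ->
  deviation (onto_boundary y) = (height y)^-1 *: y.
Proof.
move=> y0; have h0 := height_gt0 y0.
have apexE : apex_weight (onto_boundary y) = - low y / height y.
  rewrite /apex_weight; under eq_bigr do rewrite place_rim.
  rewrite -mulr_suml; apply: (mulIf (lt0r_neq0 h0)).
  by rewrite mulrBl !divfK ?gt_eqF // mul1r {1}/height; ring.
apply/rowP => j.
by rewrite mxE apexE place_rim -mulrBl opprK subrK mxE mulrC.
Qed.

(** The minimum of the coordinates of [x], taken at the [b j] and the apex, is 0,
    so subtracting the minimum from the deviation undoes the subtraction of the
    weight of the apex.  The scale [a] cancels; it stands for the normalization. *)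
Lemma onto_boundary_deviation x (a : R) : 0 < a ->
  (forall j, 0 <= x ord0 (b j)) -> 0 <= apex_weight x ->
  apex_weight x = 0 \/ (exists j, x ord0 (b j) = 0) ->
  onto_boundary (a *: deviation x) =
    place (apex_weight x) (fun j => x ord0 (b j)).
Proof.
move=> a0 x0 c0 xmin; set c := apex_weight x; set y := a *: _.
have yE j : y ord0 j = a * (x ord0 (b j) - c) by rewrite !mxE.
have lowE : low y = - (a * c).
  apply/eqP; rewrite eq_le; apply/andP; split; last first.
    apply: le_bigmin => [|j _]; first by rewrite oppr_le0 mulr_ge0 // ltW.
    by rewrite yE [leRHS]mulrBr lerDr mulr_ge0 // ltW.
  have [c_eq0|[j xj0]] := xmin; first by rewrite /c c_eq0 mulr0 oppr0 low_le0.
  by rewrite (le_trans (low_le y j)) // yE xj0 sub0r mulrN.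
have diffE j : y ord0 j - low y = a * x ord0 (b j) by rewrite yE lowE; ring.
have heightE : height y = a.
  rewrite /height; under eq_bigr do rewrite diffE.
  by rewrite lowE opprK -mulr_sumr /c /apex_weight; ring.
apply/rowP => i; rewrite !mxE; congr (_ * _ + _).
  by rewrite lowE opprK heightE mulrC mulKf ?gt_eqF.
by apply: eq_bigr => j _; rewrite diffE heightE mulrC mulKf ?gt_eqF.
Qed.

Lemma rimP i : reflect (i = z \/ exists j, i = b j) (i \in rim).
Proof.
apply: (iffP setU1P) => -[->|]; [by left| |by left|].
  by case/imsetP => j _ ->; right; exists j.
by case=> j ->; right; apply: imset_f.
Qed.

Variable K : simplicial_complex 'I_n.
Hypothesis K_proper :
  forall s : {set 'I_n}, s != finset.set0 -> s \proper rim -> simplices K s.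
Hypothesis K_rim : ~ simplices K rim.
Hypothesis K_to_rim :
  forall s, simplices K s -> simplices K (s :|: to_rim @: s)%SET.

Lemma apex_ge0 x : realization R K x -> 0 <= apex_weight x.
Proof. by case=> x0 x1 _; rewrite apex_weightE // sumr_ge0. Qed.

Lemma apex_to_rim x : realization R K x -> apex_weight x != 0 ->
  z \in (to_rim @: [set i | x ord0 i != 0])%SET.
Proof.
case=> _ x1 _; rewrite apex_weightE // => c0.
have /existsP[i /andP[ib xi]] :
    [exists i, (i \notin codom b) && (x ord0 i != 0)].
  apply: contraNT c0 => /existsPn xb; apply/eqP/big1 => i ib.
  by have := xb i; rewrite ib negbK => /eqP.
by apply/imsetP; exists i; rewrite ?inE // /to_rim (negbTE ib).
Qed.

(** Otherwise the support of [x] and its image under [to_rim] would together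
    contain the whole rim, which is not a simplex. *)
Lemma rim_min0 x : realization R K x ->
  apex_weight x = 0 \/ exists j, x ord0 (b j) = 0.
Proof.
move=> xK; have [->|c0] := eqVneq (apex_weight x) 0; first by left.
have [/existsP[j /eqP xj]|/existsPn xb] := boolP [exists j, x ord0 (b j) == 0].
  by right; exists j.
case: K_rim; have [_ _ Kx] := xK.
apply: simplices_sub (K_to_rim Kx) _ _; last first.
  by apply/set0Pn; exists z; rewrite setU11.
apply/fintype.subsetP => i /rimP[->|[j ->]]; apply/setUP; [right|left].
  exact: apex_to_rim.
by rewrite inE.
Qed.

(** Otherwise all p + 1 weights would be equal, hence all 0 since the minimum is
    0, whereas they sum to 1. *)
Lemma deviation_neq0 x : realization R K x -> deviation x != 0.
Proof.
move=> xK; apply/eqP => /rowP dx.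
have xb j : x ord0 (b j) = apex_weight x.
  by have := dx j; rewrite !mxE => /eqP; rewrite subr_eq0 => /eqP.
have c0 : apex_weight x = 0 by case: (rim_min0 xK) => // -[j <-]; rewrite xb.
have : apex_weight x = 1.
  by rewrite {1}/apex_weight big1 ?subr0 // => j _; rewrite xb.
by rewrite c0 => /eqP; rewrite eq_sym oner_eq0.
Qed.

Lemma onto_boundary_realization y : y != 0 -> realization R K (onto_boundary y).
Proof.
move=> y0; have h0 := height_gt0 y0.
have sum1 : \sum_i onto_boundary y ord0 i = 1.
  rewrite sum_place -mulr_suml -mulrDl -/(height y) mulfV //.
  exact: lt0r_neq0.
split=> // [i|].
  apply: place_ge0 => [|j]; apply: divr_ge0; rewrite ?(ltW h0) //.
    by rewrite oppr_ge0 low_le0.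
  by rewrite subr_ge0 low_le.
apply: K_proper.
  apply/set0Pn; apply/existsP; apply: contra_eqT sum1 => /existsPn zs.
  rewrite big1 ?(eq_sym 0) ?oner_eq0 // => i _.
  by have := zs i; rewrite inE negbK => /eqP.
apply/properP; split.
  apply/fintype.subsetP => i; rewrite inE => /place_support[[-> _]|[j -> _]].
    by apply/rimP; left.
  by apply/rimP; right; exists j.
case: (low_attained y) => [ly|[j ly]].
  exists z; first by apply/rimP; left.
  by rewrite inE negbK place_apex ly oppr0 mul0r.
exists (b j); first by apply/rimP; right; exists j.
by rewrite inE negbK place_rim ly subrr mul0r.
Qed.

(** A complex that retracts onto the boundary of a p-simplex by a simplicial map
    contiguous to the identity is a sphere of dimension p - 1 up to homotopy. *)
Lemma homotopy_equiv_sphere :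
  homotopy_equiv R (realization R K) (unit_sphere R p).
Proof.
have f_in x : realization R K x -> unit_sphere R p (normalize (deviation x)).
  by move=> xK; exact/normalize_sphere/deviation_neq0.
have g_in y : unit_sphere R p y -> realization R K (onto_boundary y).
  by move=> /sphere_neq0; exact: onto_boundary_realization.
apply: (@convex_homotopy_equiv _ _ _ _ _ (corestrict f_in) (corestrict g_in)).
- apply: corestrict_continuous => x xK.
  apply: (@continuous_comp _ _ _ deviation); first exact: deviation_continuous.
  exact: normalize_continuous (deviation_neq0 xK).
- apply: corestrict_continuous => y yS.
  exact: onto_boundary_continuous (sphere_neq0 yS).
- move=> y; apply: val_inj => /=; have y0 := sphere_neq0 (set_valP y).
  rewrite deviation_onto_boundary // normalize_id ?invr_gt0 ?height_gt0 //.
  exact/unit_sphereE/set_valP.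
move=> a t t01; have aK := set_valP a; have [a0 _ Ka] := aK.
have gfK := g_in _ (f_in _ aK).
apply: (segment_in_realization gfK aK (K_to_rim Ka)) => // i; last first.
  by move=> ai; apply/setUP; left; rewrite inE.
rewrite /= onto_boundary_deviation ?invr_gt0 ?enorm_gt0 ?deviation_neq0 //;
  last 2 first.
- exact: apex_ge0.
- exact: rim_min0.
move=> /place_support[[-> c0]|[j -> xj]]; apply/setUP; [right|left].
  exact: apex_to_rim.
by rewrite inE.
Qed.

End SphereCoordinates.

(** * Firing sets of a configuration with a single zero *)

(** The entries of every configuration are 0 or 1, so each vertex is emptied at
    each step and its new content is the old content of its predecessor. *)
Lemma firing_set_shift n (c0 : configuration n) (k : 'I_n) (t : nat) :
    (forall i, c0 i = (i != k)) ->
  firing_set (config_at c0 t) =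
    [set i : 'I_n | (t <= i) && (i != k + t :> nat)]%N%SET.
Proof.
move=> c0E.
suff ctE i : config_at c0 t i = ((t <= i) && (i != k + t :> nat))%N.
  by apply/setP=> i; rewrite !inE ctE; case: (_ && _).
elim: t => [|t IH] in i *; first by rewrite /config_at /= c0E addn0.
rewrite /config_at iterS -/(config_at c0 t) ffunE inE IH.
set b := (_ && _); set e := [exists _ in _, _].
have -> : (b - (1 <= b)%N = 0)%N by case: b.
rewrite add0n; congr (nat_of_bool _); apply/existsP/idP => [[j]|].
  move=> /andP[]; rewrite inE IH /path_edge lt0b => tj /eqP ij.
  by rewrite /b ij; lia.
move=> ti; have jn : (i.-1 < n)%N by have := ltn_ord i; lia.
exists (Ordinal jn); rewrite inE IH /path_edge lt0b /=; move: ti.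
by rewrite /b; lia.
Qed.

Lemma binary_single_zero n (c : configuration n) : (0 < n)%N -> binary c ->
  grains c = (n - 1)%N -> exists k : 'I_n, forall i, c i = (i != k).
Proof.
move=> n_gt0 cB cn.
(* Each vertex adds 1 either to [grains c] or to the number of zeros. *)
have cE i : c i = (c i != 0%N) by case: (cB i) => ->.
have : #|[set i | c i == 0%N]%SET| == 1%N.
  have : (grains c + #|[set i | c i == 0%N]%SET| = n)%N.
    rewrite /grains -sum1_card [X in (_ + X)%N]big_mkcond -big_split /=.
    rewrite -[RHS]card_ord -sum1_card; apply: eq_bigr => i _.
    by rewrite inE cE; case: (c i).
  by rewrite cn; lia.
move=> /cards1P[k kE]; exists k => i; rewrite cE; congr (nat_of_bool (~~ _)).
by have /setP/(_ i) := kE; rewrite !inE.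
Qed.

Lemma avalanche_simplicesP n (c0 : configuration n) (k : 'I_n)
    (s : {set 'I_n}) :
    (forall i, c0 i = (i != k)) ->
  simplices (avalanche_complex c0) s <->
  s != finset.set0 /\
  exists t, forall i, i \in s -> (t <= i)%N && (i != k + t :> nat)%N.
Proof.
move=> c0E; split=> -[s0].
  case=> _ [t _ <-]; rewrite (firing_set_shift t c0E) => /fintype.subsetP st.
  by split=> //; exists t => i /st; rewrite inE.
move=> [t st]; split=> //; exists (firing_set (config_at c0 t)).
  by exists t.
rewrite (firing_set_shift t c0E).
by apply/fintype.subsetP => i /st; rewrite inE.
Qed.

(** * The homotopy type of the avalanche complex *)

Section Avalanche.
Variables (R : realType) (n : nat) (c0 : configuration n) (k : 'I_n).
Hypothesis c0E : forall i, c0 i = (i != k).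

Let K := avalanche_complex c0.

Let simplexP s := avalanche_simplicesP s c0E.

(** The apex of the cone is the last vertex if [k < n./2], and the vertex of
    value [n.-1./2] if [k > n./2]. *)
Lemma avalanche_contractible : k != n./2 :> nat ->
  homotopy_equiv R (realization R K) [set (0 : R)].
Proof.
move=> kp; have kn := ltn_ord k.
case: (ltngtP k n./2) kp => // kp _.
  have vn : (n.-1 < n)%N by lia.
  apply: (@cone_contractible _ _ _ (Ordinal vn)) => [|s /simplexP[s0 [t st]]];
      apply/simplexP.
    split; first by apply/set0Pn; exists (Ordinal vn); rewrite set11.
    by exists 0%N => i /set1P ->; rewrite addn0 /=; lia.
  split; first by apply/set0Pn; exists (Ordinal vn); rewrite setU11.
  (* If sigma_t misses the last vertex, then k < t, so s avoids k and sigma_0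
     takes over. *)
  have [tk|tk] := eqVneq (k + t)%N n.-1.
    exists 0%N => i /setU1P[->|/st]; rewrite /=; lia.
  have [j /st js] := set0Pn _ s0; have jn := ltn_ord j.
  exists t => i /setU1P[->|/st //]; rewrite /=; lia.
have vn : (n.-1./2 < n)%N by lia.
apply: (@cone_contractible _ _ _ (Ordinal vn)) => [|s /simplexP[s0 [t st]]];
    apply/simplexP.
  split; first by apply/set0Pn; exists (Ordinal vn); rewrite set11.
  by exists 0%N => i /set1P ->; rewrite addn0 /=; lia.
split; first by apply/set0Pn; exists (Ordinal vn); rewrite setU11.
have [tv|tv] := leqP t n.-1./2.
  exists t => i /setU1P[->|/st //]; rewrite /=; lia.
(* A firing set at a later time is contained in the one at time n.-1./2, from
   which nothing is missing because k + n.-1./2 >= n. *)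
exists n.-1./2 => i; have i_n := ltn_ord i.
move=> /setU1P[->|/st]; rewrite /=; lia.
Qed.

(** The rim consists of the p = n./2 vertices of value p + j with j < p, and of
    the remaining vertex next to them: 2 p if n is odd, p - 1 if n is even. *)
Lemma avalanche_sphere : k = n./2 :> nat ->
  homotopy_equiv R (realization R K) (unit_sphere R n./2).
Proof.
move=> kp; have kn := ltn_ord k.
have bn (j : 'I_n./2) : (n./2 + j < n)%N by have := ltn_ord j; lia.
pose b j := Ordinal (bn j).
have zn : ((if odd n then n./2.*2 else n./2.-1) < n)%N by case: ifP; lia.
pose z := Ordinal zn.
have zE : z = (if odd n then n./2.*2 else n./2.-1) :> nat by [].
have b_inj : injective b by move=> i j /(congr1 val) /= /addnI /val_inj.
have bz j : b j != z.
  by have := ltn_ord j; rewrite -val_eqE /=; case: ifP; lia.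
have bE j : b j = (n./2 + j)%N :> nat by [].
clearbody b z; have simplexPp := simplexP; rewrite kp in simplexPp.
apply: (homotopy_equiv_sphere R b_inj bz).
(* A set that misses p + j lies in sigma_j, and one that misses the apex lies
   in sigma_p. *)
- move=> s s0 /properP[/fintype.subsetP s_rim [w w_rim ws]].
  apply/simplexPp; split=> //; case/rimP: w_rim => [wz|[j wj]].
    exists n./2 => i is_; case/rimP: (s_rim _ is_) => [iz|[j ->]].
      by rewrite wz -iz is_ in ws.
    by have := ltn_ord j; rewrite bE; lia.
  have jp := ltn_ord j; exists j => i is_; apply/andP; split.
    case/rimP: (s_rim _ is_) => [->|[l ->]]; last by rewrite bE; lia.
    by rewrite zE; case: ifP; lia.
  apply: contraNneq ws => ij; rewrite wj (_ : b j = i) //.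
  by apply: val_inj; rewrite /= bE.
(* If sigma_t contains the rim, then t < p because it contains p and the apex,
   but for t < p it misses p + t, which is on the rim. *)
- move=> /simplexPp[_ [t rimt]].
  have bt (j : 'I_n./2) : (t <= n./2 + j)%N && (n./2 + j != n./2 + t)%N.
    by rewrite -bE; apply: rimt; apply/rimP; right; exists j.
  have zt : (t <= z)%N && (z != n./2 + t :> nat).
    by apply: rimt; apply/rimP; left.
  have [tp|tp] := ltnP t n./2.
    by have := bt (Ordinal tp); rewrite eqxx andbF.
  move: zt; rewrite zE; case: ifP => n_odd; last by lia.
  have [p0|p0] := posnP n./2; first by lia.
  by have /andP[] := bt (Ordinal p0); rewrite /=; lia.
- move=> s /simplexPp[s0 [t st]].
  (* For t > p the simplex avoids p, so it lies in sigma_0. *)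
  have {t st} [t tp st] : exists2 t, (t <= n./2)%N &
      forall i, i \in s -> (t <= i)%N && (i != n./2 + t :> nat).
    have [tp|tp] := leqP t n./2; first by exists t.
    have [j js] := set0Pn _ s0; have jn := ltn_ord j.
    by exists 0%N => // i /st; have := st _ js; lia.
  apply/simplexPp; split; first by rewrite finset.setU_eq0 negb_and s0.
  exists t => i /setUP[/st //|/imsetP[v vs ->]]; rewrite /to_rim.
  have [_|vb] := boolP (v \in codom b); first exact: st.
  have [tp'|pt] := ltnP t n./2; first by rewrite zE; case: ifP; lia.
  (* For t = p the simplex lies in {p, ..., 2 p - 1}, where to_rim is the
     identity. *)
  have /andP[tv vt] := st _ vs; have vn := ltn_ord v.
  have vj : (v - n./2 < n./2)%N by lia.
  case/codomP: vb; exists (Ordinal vj); apply: val_inj; rewrite /= bE /=; lia.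
Qed.

End Avalanche.

Theorem proposition3p10 (R : realType) (n : nat) (c0 : configuration n)
    (n_gt0 : (0 < n)%N) (c0_binary : binary c0)
    (c0_grains : grains c0 = (n - 1)%N) :
  if [exists i : 'I_n, (i.+1 == n./2 + 1)%N && (c0 i == 0%N)]
  then homotopy_equiv R (realization R (avalanche_complex c0))
                        (unit_sphere R n./2)
  else homotopy_equiv R (realization R (avalanche_complex c0))
                        [set (0 : R)].
Proof.
have [k c0E] := binary_single_zero n_gt0 c0_binary c0_grains.
case: existsP => [[i /andP[/eqP ip]]|nk].
  rewrite c0E eqb0 negbK => /eqP ik; apply: (avalanche_sphere R c0E).
  by rewrite -ik; lia.
apply: (avalanche_contractible R c0E); apply/eqP => kp; apply: nk.
by exists k; rewrite c0E eqxx kp addn1 eqxx.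
Qed.
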